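(* Suppose $1<p<\infty$ and $0<s<1$. Let $f$ be the symbol of a bounded multiplication operator $M_f$ on $\mathcal{Q}_s^p(\mathbb{D})$. Then $\sigma(M_f)=\overline{f(\mathbb{D})}$.
   Context: $\mathbb{D}$ is the open unit disk and $dA$ is Lebesgue measure on $\mathbb{D}$. For $a\in\mathbb{D}$, $\sigma_a(z)=\frac{a-z}{1-\overline{a}z}$. $\mathcal{Q}_s^p(\mathbb{D})$ is the space of analytic functions $f$ on $\mathbb{D}$ with $\|f\|_{\mathcal{Q}_s^p(\mathbb{D})}=\sup_{a\in\mathbb{D}}\|f\circ\sigma_a\|_{B_p(s)}<\infty$, where $\|f\|_{B_p(s)}=\left(\int_{\mathbb{D}}|f'(z)|^p(1-|z|^2)^{p-2+s}\,dA(z)\right)^{1/p}$; it is a Banach space with norm $|f(0)|+\|f\|_{\mathcal{Q}_s^p(\mathbb{D})}$. The multiplication operator with symbol $f$ is $M_f(g)=fg$. For a bounded linear operator $T$ on a Banach space $X$, $\sigma(T)=\{\lambda\in\mathbb{C}:T-\lambda E\text{ is not invertible}\}$, where $E$ is the identity operator on $X$. $\overline{f(\mathbb{D})}$ is the closure in $\mathbb{C}$ of the range of $f$. *)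

(* Defs.v *)
From HB Require Import structures.
From mathcomp Require Import all_boot all_order all_algebra.
From mathcomp Require Import complex.
From mathcomp Require Import all_classical all_reals all_analysis.

Set Implicit Arguments.
Unset Strict Implicit.
Unset Printing Implicit Defensive.

Import Order.TTheory GRing.Theory Num.Theory.
Import numFieldNormedType.Exports.

Local Open Scope classical_set_scope.
Local Open Scope ring_scope.
Local Open Scope complex_scope.

(* A normed space is given here by its carrier [X], a set of vectors of an
   ambient module [V], and by its norm [N], of which only the values on [X]
   matter.  An operator on it is a map [V -> V], of which again only the values
   on [X] matter. *)
Section Operators.
Context (K : numFieldType) (V : lmodType K) (R : realType).
Implicit Types (X : set V) (N : V -> R) (T S : V -> V).

Definition bounded_operator X N T : Prop :=
  [/\ forall x, X x -> X (T x),
      forall (a : K) x y, X x -> X y -> T (a *: x + y) = a *: T x + T y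
    & exists M : R, forall x, X x -> N (T x) <= M * N x].

Definition invertible_operator X N T : Prop :=
  exists S, bounded_operator X N S /\
    forall x, X x -> S (T x) = x /\ T (S x) = x.

Definition spectrum X N T : set K :=
  [set l | ~ invertible_operator X N (fun x => T x - l *: x)].

End Operators.

(* The topology, the norm and the complex derivative that the library provides
   on [R[i]] are attached to [R[i]^o], seen as a module over [R[i]]. *)
Section Disk.
Context (R : realType).
Local Notation C := (R[i]^o).

Definition disk : set C := [set z | Normc.normc z < 1].

Definition disk_aut (a z : C) : C := (a - z) / (1 - a^* * z).

(* A function on the disk is represented by its extension by 0 to the plane,
   so that equality of representatives is equality of functions on the disk.
   Differentiability is over the complex field, and at a point of the open disk
   it only depends on the values in the disk. *)
Definition analytic_on_disk (f : C -> C) : Prop :=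
  (forall z, ~ disk z -> f z = 0) /\ (forall z, disk z -> derivable f z 1).

(* Plane Lebesgue measure is the product measure on [R * R]. *)
Definition Bp_seminorm (p s : R) (f : C -> C) : \bar R :=
  ((\int[(lebesgue_measure \x lebesgue_measure)%E]_(w in
        [set w : R * R | disk (w.1 +i* w.2)])
      (Normc.normc (derive1 f (w.1 +i* w.2)) `^ p *
       (1 - Normc.normc (w.1 +i* w.2) ^+ 2) `^ (p - 2 + s))%:E) `^ p^-1)%E.

Definition Qsp_seminorm (p s : R) (f : C -> C) : \bar R :=
  ereal_sup [set Bp_seminorm p s (f \o disk_aut a) | a in disk].

Definition Qsp (p s : R) : set (C -> C) :=
  [set f | analytic_on_disk f /\ (Qsp_seminorm p s f < +oo)%E].

(* On [Qsp] the seminorm is finite, so that [fine] loses nothing there. *)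
Definition Qsp_norm (p s : R) (f : C -> C) : R :=
  Normc.normc (f 0) + fine (Qsp_seminorm p s f).

Definition mul_operator (f : C -> C) : (C -> C) -> (C -> C) :=
  fun g z => f z * g z.

End Disk.

(* Main.v *)
Require Import Defs.
From mathcomp Require Import all_boot all_order all_algebra.
From mathcomp Require Import complex.
From mathcomp Require Import all_classical all_reals all_analysis.
From mathcomp Require Import measurable_realfun ring lra.
Import Order.TTheory GRing.Theory Num.Theory.
Import numFieldNormedType.Exports.
Local Open Scope classical_set_scope.
Local Open Scope ring_scope.

(** The operator M_f - l is invertible exactly when f stays at a positive
    distance from l on the disk; since closure (f(D)) is the complement of the
    set of such l, this is the theorem.

    If |f - l| >= delta on the disk, the inverse is multiplication by
    1 / (f - l).  To see that it maps the space to itself, compose with an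
    automorphism of the disk, put phi = f o sigma_a, G = g o sigma_a and
    P = phi G, and eliminate phi' between the product rules for P and for
    H = G / (phi - l):
      H' = - P' / (phi - l)^2 + (2 / (phi - l) + l / (phi - l)^2) G'.
    Hence |H'| <= c (|P'| + |G'|) with c depending on delta and l only, and the
    seminorm of g / (f - l) is bounded by those of f g and g, both controlled
    by the norm of g ([energy_le_add], [quotient_derive_bound],
    [invertible_of_far]).

    Conversely an inverse S, of norm at most M say, multiplies by some h with
    (f - l) h = 1, and it has to be shown that h is bounded.  Its powers are
    the S^n 1, of norm at most M^n.  For k (z) = h (- z) the derivative of the
    n-th power is n k^(n-1) k', so that for r > M the integral of |k'|^p,
    against the positive weight, over the set where |k| > r is
    O ((M / r)^(p n)) for every n, hence zero: almost everywhere either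
    |k| <= r or k' = 0 ([moving_set_null]).  The function max (0, |k| - r)^2
    then has vanishing derivative at almost every point, and is pointwise
    Lipschitz at every point.  By Fubini almost every horizontal or vertical
    line meets the exceptional set in a null set, and on such a line the
    function is constant: a function of one variable that is pointwise
    Lipschitz everywhere and has derivative zero almost everywhere is constant
    ([ae_flat_cst]).  By continuity it is constant on all horizontal and
    vertical chords, so on the disk ([ae_flat_disk_cst]), where it equals its
    value at 0, namely 0, because |h (0)| is at most the norm of h, which is
    at most M.  Thus |h| <= r, which keeps f away from l ([invertible_far]).  All that is known
    about h is that it has a complex derivative at each point, and this is
    why the one-variable statement is about pointwise differentiability. *)

Set Implicit Arguments.
Unset Strict Implicit.
Unset Printing Implicit Defensive.

(** * Functions of one variable that are flat almost everywhere *)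

(** A null set N lies in open sets G_k of measure at most e / 2^(k+1).  The sum
    over k of the measures of the intersections of G_k with ]-oo, x] is bounded
    by e, and grows at infinite rate at each point of N because such a point
    is interior to every G_k. *)
Lemma negligible_steep (R : realType) (N : set R) (e : R) : 0 < e ->
  (@lebesgue_measure R).-negligible N ->
  exists psi : R -> R, [/\ {homo psi : x y / x <= y},
    forall x, 0 <= psi x <= e &
    forall x K, N x -> \forall y \near x, x <= y -> psi x + K * (y - x) <= psi y].
Proof.
move=> e0 [N' [mN' N'0 NN']].
pose mu : {measure set (measurableTypeR R) -> \bar R} := @lebesgue_measure R.
have H k : exists U : set R,
    [/\ open U, N' `<=` U & (mu U <= (e / (2 ^ k.+1)%:R)%:E)%E].
  have ek0 : 0 < e / (2 ^ k.+1)%:R by rewrite divr_gt0// ltr0n expn_gt0.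
  have N'oo : (mu N' < +oo)%E by rewrite [mu _]N'0.
  have [U [oU NU muU]] := lebesgue_regularity_outer mN' N'oo ek0.
  exists U; split => //.
  have mU : measurable U by exact: open_measurable.
  rewrite -(setUIDK U N') measureU//=; last 3 first.
  - exact: measurableI.
  - exact: measurableD.
  - by rewrite setDE setIACA setICr setI0.
  by rewrite (setIidr NU) [X in (X + _)%E]N'0 add0e ltW.
have {H} /choice[G HG] := H.
have mG k : measurable (G k) by apply: open_measurable; have [] := HG k.
pose m k x := mu (G k `&` `]-oo, x]).
have mI k x : measurable (G k `&` `]-oo, x]) by apply: measurableI => //; exact: measurable_itv.
have m0 k x : (0 <= m k x)%E by exact: measure_ge0.
have le_mu (A B : set R) : measurable A -> measurable B -> A `<=` B -> (mu A <= mu B)%E.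
  by move=> mA mB AB; apply: le_measure => //; exact: mem_set.
pose phi x := (\sum_(0 <= k <oo) m k x)%E.
have phi0 x : (0 <= phi x)%E by apply: nneseries_ge0 => *; exact: m0.
have phie x : (phi x <= e%:E)%E.
  apply: le_trans (epsilon_trick0 xpredT (ltW e0)).
  apply: lee_nneseries => [k _ _|k _]; first exact: m0.
  have [_ _ +] := HG k.
  by apply: le_trans; apply: le_mu => //; exact: subIsetl.
have phifin x : phi x \is a fin_num.
  by rewrite ge0_fin_numE// (le_lt_trans (phie x))// ltry.
exists (fine \o phi); split.
- move=> x y xy; rewrite fine_le//; apply: lee_nneseries => [k _ _|k _]; first exact: m0.
  apply: le_mu => //; apply: setIS => z /=.
  by rewrite !in_itv/= => /le_trans; exact.
- by move=> x /=; rewrite fine_ge0//= -lee_fin fineK.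
- move=> x K Nx.
  pose n := Num.bound `|K|.
  have Kn : K <= n%:R.
    by apply: le_trans (ler_norm _) _; apply: ltW; apply: archi_boundP.
  have : \forall y \near x, forall k, (k < n)%N -> `]x, y] `<=` G k.
    have : forall k, \forall y \near x, `]x, y] `<=` G k.
      move=> k; have [oG NG _] := HG k.
      have /nbhs_ballP[d /= d0 dG] := oG _ (NG _ (NN' _ Nx)).
      exists d => //= y /=; rewrite /ball/= => xyd z /=; rewrite in_itv/= => /andP[xz zy].
      apply: dG; rewrite /ball/= distrC ger0_norm ?subr_ge0 1?ltW//.
      rewrite distrC in xyd.
      apply: le_lt_trans xyd; apply: le_trans (ler_norm _); lra.
    move=> Hk.
    have : \forall y \near x, forall k : 'I_n, `]x, y] `<=` G k.
      by apply: (@filter_forall R _ (fun (k : 'I_n) y => `]x, y] `<=` G k) (nbhs x)) => k; exact: Hk.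
    by apply: filterS => y Hy k kn; exact: (Hy (Ordinal kn)).
  apply: filterS => y Gy xy.
  rewrite /= -lee_fin EFinD !fineK//.
  (* The first n of the G_k contain ]x, y], so each contributes y - x. *)
  pose c k := if (k < n)%N then ((y - x)%:E)%E else 0%E.
  apply: (@le_trans _ _ (\sum_(0 <= k <oo) (m k x + c k))%E).
    rewrite nneseriesD//; last first.
      by move=> k _; rewrite /c; case: ifP => //; rewrite lee_fin subr_ge0.
    apply: leeD2l.
    apply: (@le_trans _ _ (\sum_(0 <= k < n) c k)%E); last first.
      by apply: nneseries_lim_ge => k _; rewrite /c; case: ifP => //; rewrite lee_fin subr_ge0.
    rewrite (eq_big_nat _ _ (F2 := fun=> (y - x)%:E)); last first.
      by move=> k /= kn; rewrite /c kn.
    rewrite sumEFin lee_fin big_const_nat subn0 iter_addr_0 -mulr_natr mulrC.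
    by apply: ler_wpM2l => //; rewrite subr_ge0.
  apply: lee_nneseries => [k _ _|k _].
    by rewrite adde_ge0// /c; case: ifP => //; rewrite lee_fin subr_ge0.
  rewrite /c; case: ifPn => kn; last first.
    rewrite adde0; apply: le_mu => //; apply: setIS => z /=.
    by rewrite !in_itv/= => /le_trans; exact.
  have -> : (y - x)%:E = mu [set` `]x, y]].
    symmetry; etransitivity; first exact: lebesgue_measure_itv.
    rewrite /= lte_fin; case: ltP => // yx.
    by rewrite (@le_anti _ _ x y) ?xy// subrr.
  rewrite /m -measureU//=.
  + apply: le_mu => //.
      by apply: measurableU => //; exact: measurable_itv.
    move=> z [[Gz /= ]|/= zxy]; rewrite in_itv/=.
      by move=> zx; split => //=; rewrite in_itv/= (le_trans zx).
    split; first exact: (Gy k).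
    by move: zxy; rewrite /= !in_itv/= => /andP[].
  + exact: mI.
  + apply/seteqP; split => // z [[_ /=] + /=].
    by rewrite !in_itv/= => zx; rewrite ltNge zx.
Qed.

(** Up to e, the growth of [F] from [a] is at most that of [e * (x - a) + psi x]
    with [psi] steep on [N]: at a point outside [N] the linear term dominates, and
    at a point of [N] the steepness of [psi] beats whatever Lipschitz constant [F]
    has there.  The set where the comparison fails has no infimum, because the
    comparison extends to limits from the left and to some interval on the
    right of each point. *)
Lemma ae_flat_cst (R : realType) (F : R -> R) (N : set R) (a b : R) : a <= b ->
  (@lebesgue_measure R).-negligible N ->
  (forall x, a <= x <= b ->
    exists K, \forall y \near x, `|F y - F x| <= K * `|y - x|) ->
  (forall x, a <= x <= b -> ~ N x -> forall e, 0 < e ->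
    \forall y \near x, `|F y - F x| <= e * `|y - x|) ->
  F a = F b.
Proof.
move=> ab N0 Flip Fflat.
suff H e : 0 < e -> `|F b - F a| <= e * (b - a) + e.
  apply/eqP; rewrite eq_sym -subr_eq0 -normr_le0; apply/ler_addgt0Pr => e e0.
  rewrite add0r; have ba1 : 0 < b - a + 1 by rewrite ltr_wpDl ?subr_ge0.
  apply: le_trans (H (e / (b - a + 1)) _) _; first by rewrite divr_gt0.
  by rewrite (_ : _ + _ = e)//; field; rewrite gt_eqF.
move=> e0.
have [psi [psi_nd psi_e psi_N]] := negligible_steep e0 N0.
pose P x := `|F x - F a| <= e * (x - a) + psi x.
have Pa : P a.
  by rewrite /P !subrr normr0 mulr0 add0r; have /andP[] := psi_e a.
have fwd x : a <= x <= b -> P x -> exists2 d, 0 < d &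
    forall y, x <= y < x + d -> P y.
  move=> axb Px.
  suff : \forall y \near x, x <= y -> `|F y - F x| + psi x <= e * (y - x) + psi y.
    move=> /nbhs_ballP[d /= d0 dP]; exists d => // y /andP[xy yd].
    have := dP y; rewrite /ball/= ler0_norm ?subr_le0// opprB ltrBlDl => /(_ yd xy).
    move: Px; rewrite /P => Px Hy.
    have := ler_normD (F y - F x) (F x - F a); rewrite addrA subrK; lra.
  have [Nx|Nx] := pselect (N x).
    have [K FK] := Flip _ axb.
    near=> y => xy.
    have : psi x + K * (y - x) <= psi y.
      by move: xy; near: y; exact: psi_N.
    have : `|F y - F x| <= K * `|y - x| by near: y.
    rewrite (ger0_norm (_ : 0 <= y - x)) ?subr_ge0//.
    have : 0 <= e * (y - x) by apply: mulr_ge0; [exact: ltW|rewrite subr_ge0].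
    lra.
  near=> y => xy.
  have : `|F y - F x| <= e * `|y - x| by near: y; exact: Fflat Nx _ e0.
  rewrite (ger0_norm (_ : 0 <= y - x)) ?subr_ge0//.
  have := psi_nd _ _ xy; lra.
suff : P b by have /andP[_] := psi_e b; rewrite /P; lra.
have [//|nPb] := pselect (P b).
(* B is the set where the comparison fails, and c its infimum. *)
pose B := [set x | a <= x <= b /\ ~ P x].
have B0 : B b by split => //; rewrite ab lexx.
have lbB : has_inf B by split; [exists b|exists a => x [/andP[]]].
pose c := inf B.
have ac : a <= c by apply: lb_le_inf; [exists b|move=> x [/andP[]]].
have cb : c <= b by apply: ge_inf => //; case: lbB.
have Plt x : a <= x < c -> P x.
  move=> /andP[ax xc]; apply: contrapT => nPx.
  have : c <= x by apply: ge_inf; [case: lbB|split => //; rewrite ax (le_trans (ltW xc))].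
  by rewrite leNgt xc.
have Pc : P c.
  have [->//|ac'] := eqVneq c a.
  have {}ac : a < c by rewrite lt_neqAle eq_sym ac'.
  rewrite /P; apply/ler_addgt0Pr => eta eta0.
  have [K FK] : exists K, \forall y \near c, `|F y - F c| <= K * `|y - c|.
    by apply: Flip; rewrite (ltW ac).
  have [d d0 Hd] : exists2 d, 0 < d & forall y, `|y - c| < d -> `|F y - F c| <= K * `|y - c|.
    move/nbhs_ballP : FK => [d /= d0 dP]; exists d => // y yc; apply: dP.
    by rewrite /ball/= distrC.
  pose K' := `|K| + 1.
  have K'0 : 0 < K' by rewrite ltr_wpDl.
  (* A point so close to the left of c that F varies by at most eta from t to c. *)
  pose t := Num.max a (c - Num.min (d / 2) (eta / K')).
  have m0 : 0 < Num.min (d / 2) (eta / K').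
    by rewrite lt_min !divr_gt0.
  have tc : t < c by rewrite gt_max ac/= gtrBl.
  have at_ : a <= t by rewrite le_max lexx.
  have tc' : `|t - c| <= Num.min (d / 2) (eta / K').
    rewrite ler0_norm ?subr_le0 ?(ltW tc)// opprB lerBlDl -lerBlDr.
    by rewrite le_max lexx orbT.
  have := Plt t; rewrite at_ tc /P => /(_ isT) Pt.
  have Ftc : `|F t - F c| <= eta.
    apply: le_trans (Hd _ _) _.
      by move: tc'; rewrite le_min => /andP[+ _]; lra.
    apply: (@le_trans _ _ (K' * `|t - c|)).
      by apply: ler_wpM2r => //; rewrite /K'; have := ler_norm K; lra.
    rewrite mulrC -ler_pdivlMr//; move: tc'; rewrite le_min => /andP[]//.
  have := psi_nd _ _ (ltW tc).
  have : e * (t - a) <= e * (c - a) by rewrite ler_pM2l//; lra.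
  have := ler_distD (F t) (F c) (F a); rewrite (distrC (F c) (F t)).
  lra.
have acb : a <= c <= b by rewrite ac.
have [d d0 dP] := fwd c acb Pc.
have [x [axb nPx] xcd] := inf_adherent d0 lbB.
case: (nPx); apply: dP; rewrite xcd andbT.
by apply: ge_inf; [case: lbB|split].
Unshelve. all: by end_near. Qed.

(** * Derivatives over a field *)

(** These rules are stated over an abstract field so that no computation with
    complex numbers is ever attempted when they are unified with a goal. *)
Section DeriveField.
Variable K : numFieldType.
Implicit Types (F G : K^o -> K^o) (x dF dG : K^o).

Lemma is_derive_mul F G x dF dG : is_derive x 1 F dF -> is_derive x 1 G dG ->
  is_derive x 1 (fun w => F w * G w) (F x * dG + G x * dF).
Proof. by move=> H1 H2; exact: is_deriveM. Qed.

Lemma is_derive_add F G x dF dG : is_derive x 1 F dF -> is_derive x 1 G dG ->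
  is_derive x 1 (fun w => F w + G w) (dF + dG).
Proof. by move=> H1 H2; exact: is_deriveD. Qed.

Lemma is_derive_is_diff F x dF :
  is_derive x 1 F dF <-> is_diff x F (fun h : K^o => h * dF).
Proof.
split=> [[dd dv]|[dd dv]].
  have df : differentiable F x by apply/derivable1_diffP.
  by apply: DiffDef => //; rewrite diff1E// derive1E dv.
have df : derivable F x 1 by apply/derivable1_diffP.
apply: DeriveDef => //; rewrite -derive1E.
have := diff1E dd; rewrite dv => /(congr1 (fun u => u 1)).
by rewrite mul1r scale1r => ->.
Qed.

Lemma is_derive_comp F G x dF dG : is_derive x 1 F dF ->
  is_derive (F x) 1 G dG -> is_derive x 1 (G \o F) (dG * dF).
Proof.
move=> /is_derive_is_diff dF' /is_derive_is_diff dG'; apply/is_derive_is_diff.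
have -> : (fun h : K^o => h * (dG * dF)) =
    (fun h : K^o => h * dG) \o (fun h : K^o => h * dF).
  by apply/funext => h /=; rewrite -mulrA (mulrC dF).
exact: is_diff_comp.
Qed.

Lemma is_derive_inv x : x != 0 -> is_derive x 1 (fun w : K^o => w^-1) (- x ^- 2).
Proof.
move=> x0; apply/is_derive_is_diff.
have d := differentiable_Rinv x0.
apply: DiffDef => //; rewrite diff_Rinv//; apply/funext => h.
exact: mulrC.
Qed.

Lemma is_derive_expr F x dF n : is_derive x 1 F dF ->
  is_derive x 1 (fun w => F w ^+ n.+1) (n.+1%:R * F x ^+ n * dF).
Proof.
move=> dF1; elim: n => [|n IH].
  by rewrite expr0 mulr1 mul1r; under eq_fun do rewrite expr1.
under eq_fun do rewrite exprS.
have -> : n.+2%:R * F x ^+ n.+1 * dF =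
    F x * (n.+1%:R * F x ^+ n * dF) + F x ^+ n.+1 * dF.
  by rewrite [in RHS]exprS -[in LHS]addn1 natrD exprS; ring.
exact: is_derive_mul.
Qed.

Lemma is_derive_bound F x dF : is_derive x 1 F dF -> forall e : K, 0 < e ->
  \forall w \near x, `|F w - F x - dF * (w - x)| <= e * `|w - x|.
Proof.
move=> [dd dv] e e0.
have : (h^-1 *: (F (h *: 1 + x) - F x) @[h --> 0^'] --> dF) by rewrite -dv; exact: dd.
move=> /cvgrPdist_le /(_ e e0).
move=> /nbhs_ballP[d /= d0 dP]; apply/nbhs_ballP; exists d => // w.
rewrite /ball/= => xw.
have [->|wx] := eqVneq w x; first by rewrite !subrr mulr0 subrr normr0 mulr0.
have wx0 : w - x != 0 by rewrite subr_eq0.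
have := dP (w - x); rewrite /ball/= sub0r opprB => /(_ xw wx0).
rewrite /GRing.scale/= mulr1 subrK => H.
rewrite -ler_pdivrMr ?normr_gt0// -normf_div.
rewrite mulrBl mulfK//; rewrite distrC mulrC in H; exact: H.
Qed.

Lemma is_derive_derive1 F x dF : is_derive x 1 F dF -> derive1 F x = dF.
Proof. by move=> [_ dv]; rewrite derive1E. Qed.

End DeriveField.

(** * The modulus of complex numbers *)
Section ComplexNorm.
Local Open Scope complex_scope.
Variable R : realType.
Local Notation C := (R[i]^o).
Local Notation normc := (@Normc.normc R).

Lemma normE (z : C) : `|z| = (normc z)%:C.
Proof. by []. Qed.

Lemma nbhs_normcP (z : C) (A : set C) :
  nbhs z A <-> exists2 d : R, 0 < d & forall w, normc (w - z) < d -> A w.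
Proof.
split=> [/nbhs_ballP[d /= d0 dA]|[d d0 dA]].
  exists (complex.Re d); first by move: d0; rewrite ltcE/= => /andP[].
  move=> w wz; apply: dA; rewrite /ball/= distrC normE ltcE/=.
  by move: d0; rewrite ltcE/= => /andP[/eqP-> _]; rewrite eqxx.
apply/nbhs_ballP; exists d%:C; first by rewrite /= (_ : 0 = 0%:C)// ltcR.
by move=> w; rewrite /ball/= distrC normE ltcR; exact: dA.
Qed.

Lemma normc_ge0 (z : C) : 0 <= normc z.
Proof. by have := normr_ge0 z; rewrite normE (_ : 0 = 0%:C)// lecR. Qed.

Lemma normc_gt0 (z : C) : z != 0 -> 0 < normc z.
Proof. by move=> z0; rewrite -ltcR -normE normr_gt0. Qed.

Lemma normcX (z : C) n : normc (z ^+ n) = normc z ^+ n.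
Proof. by apply: complexI; rewrite rmorphXn/= -!normE normrX. Qed.

Lemma normc_nat n : normc (n%:R : C) = n%:R.
Proof. by apply: complexI; rewrite -normE normr_nat rmorph_nat. Qed.

Lemma normcB (z w : C) : normc (z - w) = normc (w - z).
Proof. by apply: complexI; rewrite -!normE distrC. Qed.

Lemma normcD_le (z w : C) : normc (z + w) <= normc z + normc w.
Proof. by rewrite -lecR rmorphD/= -!normE ler_normD. Qed.

Lemma normc_dist (z w : C) : `|normc z - normc w| <= normc (z - w).
Proof.
have H (u v : C) : normc u - normc v <= normc (u - v).
  by rewrite lerBlDr -{1}(subrK v u) normcD_le.
by rewrite ler_norml lerNl opprB H normcB H.
Qed.

Lemma normc_Re (z : C) : `|complex.Re z| <= normc z.
Proof. by rewrite -lecR; exact: normc_ge_Re. Qed.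

Lemma normc_Im (z : C) : `|complex.Im z| <= normc z.
Proof.
case: z => a b /=; rewrite -sqrtr_sqr ler_sqrt.
  by rewrite lerDr sqr_ge0.
by rewrite addr_ge0 ?sqr_ge0.
Qed.

Lemma is_derive_normc (F : C -> C) (z d : C) : is_derive z 1 F d ->
  forall e : R, 0 < e -> exists2 r : R, 0 < r &
    forall w, normc (w - z) < r ->
      normc (F w - F z - d * (w - z)) <= e * normc (w - z).
Proof.
move=> Fd e e0; have := is_derive_bound Fd.
have eC : 0 < e%:C by rewrite ltcR.
move=> /(_ _ eC)/nbhs_normcP[r r0 H]; exists r => // w wz.
by have := H w wz; rewrite !normE -rmorphM/= lecR.
Qed.

Lemma is_derive_lipschitz (F : C -> C) (z d : C) : is_derive z 1 F d ->
  forall e : R, 0 < e -> exists2 r : R, 0 < r &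
    forall w, normc (w - z) < r ->
      normc (F w - F z) <= (normc d + e) * normc (w - z).
Proof.
move=> Fd e e0; have [r r0 H] := is_derive_normc Fd e0.
exists r => // w wz; rewrite mulrDl -Normc.normcM.
have := normcD_le (F w - F z - d * (w - z)) (d * (w - z)).
by rewrite subrK => /le_trans; apply; rewrite addrC lerD2l; exact: H.
Qed.

End ComplexNorm.

(** * Measurability on the disk *)
Section PlaneMeasurability.
Local Open Scope complex_scope.
Variable R : realType.
Local Notation C := (R[i]^o).
Local Notation normc := (@Normc.normc R).
Local Notation plane_disk := [set w : R * R | @disk R (w.1 +i* w.2)].

Lemma normc_le_add (a b : R) : normc (a +i* b) <= `|a| + `|b|.
Proof.
rewrite /= -[leRHS]ger0_norm ?addr_ge0// -sqrtr_sqr ler_sqrt ?sqr_ge0//.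
rewrite sqrrD !real_normK ?num_real// addrAC lerDl.
by rewrite mulrn_wge0// mulr_ge0.
Qed.

Lemma disk_open (z : C) : disk z -> exists2 d : R, 0 < d &
  forall w, normc (w - z) < d -> disk w.
Proof.
rewrite /disk/= => z1; exists (1 - normc z); first by rewrite subr_gt0.
move=> w wz; have := normcD_le (w - z) z; rewrite subrK; lra.
Qed.

(** An open set of the plane is a countable union of boxes with rational
    centres. *)
Lemma box_open_measurable (A : set (R * R)) :
  (forall w, A w -> exists2 d : R, 0 < d & forall w' : R * R,
    `|w'.1 - w.1| < d -> `|w'.2 - w.2| < d -> A w') ->
  measurable A.
Proof.
move=> oA.
pose box (q : rat * rat * nat) : set (R * R) :=
  ball (ratr q.1.1 : R) (q.2.+1%:R^-1 : R) `*` ball (ratr q.1.2 : R) (q.2.+1%:R^-1 : R).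
have -> : A = \bigcup_q (if pselect (box q `<=` A) then box q else set0).
  apply/seteqP; split => [w Aw|w [q _]]; last by case: pselect => // H /H.
  have [d d0 dA] := oA w Aw.
  have d20 : 0 < d / 2 by rewrite divr_gt0.
  have [n nd] : exists n, (n.+1%:R^-1 : R) < d / 2.
    exists (Num.bound (d / 2)^-1).
    rewrite -[ltRHS]invrK ltf_pV2 ?posrE ?invr_gt0//.
    apply: lt_le_trans (archi_boundP _) _; first by rewrite invr_ge0 ltW.
    by rewrite ler_nat.
  have e0 : 0 < (n.+1%:R^-1 : R) by rewrite invr_gt0.
  have rd (x : R) : exists q : rat, `|ratr q - x| < n.+1%:R^-1.
    have xx : x - n.+1%:R^-1 < x + n.+1%:R^-1 by rewrite ltrBlDr -addrA ltrDl addr_gt0.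
    have [q] := rat_in_itvoo xx.
    rewrite in_itv/= => /andP[q1 q2]; exists q.
    by rewrite ltr_norml; apply/andP; split; [rewrite ltrBrDl|rewrite ltrBlDl].
  have [q1 Hq1] := rd w.1; have [q2 Hq2] := rd w.2.
  exists (q1, q2, n) => //; case: pselect => [?|].
    by split => /=; rewrite /ball/=.
  case=> w' [/=]; rewrite /ball/= => H1 H2.
  have near2 (a b c e : R) : `|a - b| < e -> `|a - c| < e -> e < d / 2 -> `|c - b| < d.
    by move=> ab ac ed; have := ler_distD a c b; rewrite (distrC c a); lra.
  by apply: dA; [exact: near2 Hq1 H1 nd|exact: near2 Hq2 H2 nd].
apply: countable_bigcupT_measurable => // q.
case: pselect => ?; [|exact: measurable0]; apply: measurableX; apply: open_measurable; exact: ball_open.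
Qed.

Lemma plane_disk_measurable : measurable plane_disk.
Proof.
apply: box_open_measurable => w /disk_open[d d0 dP].
exists (d / 2); first by rewrite divr_gt0.
move=> w' H1 H2; apply: dP; apply: le_lt_trans (normc_le_add _ _) _; lra.
Qed.

Lemma continuous_plane_disk_measurable (u : C -> R) :
  (forall z, disk z -> forall e, 0 < e -> exists2 d : R, 0 < d &
     forall w, normc (w - z) < d -> `|u w - u z| < e) ->
  measurable_fun plane_disk (fun w => u (w.1 +i* w.2)).
Proof.
move=> cu; apply: (measurability _ (RGenOInfty.measurableE R)).
move=> _ [_ [a ->] <-]; apply: box_open_measurable => w [/= Dw].
rewrite in_itv/= andbT => auw.
have [d1 d10 H1] := disk_open Dw.
have [|d2 d20 H2] := cu _ Dw (u (w.1 +i* w.2) - a); first by rewrite subr_gt0.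
exists (Num.min d1 d2 / 2); first by rewrite divr_gt0// lt_min d10.
move=> w' h1 h2.
have : normc ((w'.1 +i* w'.2) - (w.1 +i* w.2)) < Num.min d1 d2.
  by apply: le_lt_trans (normc_le_add _ _) _; lra.
rewrite lt_min => /andP[n1 n2]; split; first exact: H1.
rewrite /= in_itv/= andbT.
by have := H2 _ n2; rewrite ltr_norml => /andP[]; lra.
Qed.

Lemma derivable_lipschitz (G : C -> C) (z : C) : derivable G z 1 ->
  exists K, 0 < K /\ exists2 r : R, 0 < r &
    forall w, normc (w - z) < r -> normc (G w - G z) <= K * normc (w - z).
Proof.
move=> dG; have [r r0 H] := is_derive_lipschitz (derivableP dG) ltr01.
by exists (normc ('D_1 G z) + 1); split; [rewrite ltr_wpDl// normc_ge0|exists r].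
Qed.

Lemma derivable_normc_continuous (G : C -> C) (z : C) : derivable G z 1 ->
  forall e, 0 < e -> exists2 d : R, 0 < d &
    forall w, normc (w - z) < d -> normc (G w - G z) < e.
Proof.
move=> /derivable_lipschitz[K [K0 [r r0 H]]] e e0.
exists (Num.min r (e / K)); first by rewrite lt_min r0 divr_gt0.
move=> w; rewrite lt_min => /andP[wr we].
by apply: le_lt_trans (H _ wr) _; rewrite mulrC -ltr_pdivlMr.
Qed.

Variable G : C -> C.
Hypothesis dG : forall z, disk z -> derivable G z 1.

Lemma measurable_normc_disk : measurable_fun plane_disk (fun w => normc (G (w.1 +i* w.2))).
Proof.
apply: (@continuous_plane_disk_measurable (fun z => normc (G z))) => z Dz e e0.
have [d d0 H] := derivable_normc_continuous (dG Dz) e0.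
by exists d => // w /H; apply: le_lt_trans; exact: normc_dist.
Qed.

(** The modulus of the derivative is the pointwise limit of n |G (z + 1/n) - G z|.
    Since z + 1/n may leave the disk, the quotients are formed with the
    extension of G by 0. *)
Lemma measurable_normc_derive_disk :
  measurable_fun plane_disk (fun w => normc (derive1 G (w.1 +i* w.2))).
Proof.
pose D := plane_disk.
have mD : measurable D := plane_disk_measurable.
have mpart (u : C -> R) : (forall z w, `|u z - u w| <= normc (z - w)) ->
    measurable_fun setT ((fun w : R * R => u (G (w.1 +i* w.2))) \_ D).
  move=> u_lip; apply/(measurable_restrictT (D := D)) => //.
  apply: (@continuous_plane_disk_measurable (fun z => u (G z))) => z Dz e e0.
  have [d d0 H] := derivable_normc_continuous (dG Dz) e0.
  by exists d => // w /H; apply: le_lt_trans.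
have /mpart mRe : forall z w, `|complex.Re z - complex.Re w| <= normc (z - w).
  by move=> [a b] [c d]; exact: (normc_Re ((a +i* b) - (c +i* d))).
have /mpart mIm : forall z w, `|complex.Im z - complex.Im w| <= normc (z - w).
  by move=> [a b] [c d]; exact: (normc_Im ((a +i* b) - (c +i* d))).
set re := (X in measurable_fun _ X) in mRe.
set im := (X in measurable_fun _ X) in mIm.
pose e n : R := n.+1%:R^-1.
pose sh n (w : R * R) := (w.1 + e n, w.2).
have msh n : measurable_fun setT (sh n).
  by apply: measurable_fun_pair => //; apply: measurable_funD.
pose q n (w : R * R) := Num.sqrt ((re (sh n w) - re w) ^+ 2 + (im (sh n w) - im w) ^+ 2) * n.+1%:R.
apply: (@measurable_fun_cvg _ _ _ _ q) => [n|w Dw].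
  apply: measurable_funTS; apply: measurable_funM => //.
  apply: (@measurableT_comp _ _ _ _ _ _ (@Num.sqrt R)).
    by apply: continuous_measurable_fun; exact: sqrt_continuous.
  apply: measurable_funD; apply: measurable_funX; apply: measurable_funB => //.
    exact: (measurableT_comp mRe (msh n)).
  exact: (measurableT_comp mIm (msh n)).
apply/cvgrPdist_le => eta eta0.
pose z : C := w.1 +i* w.2.
have [r r0 Hr] := is_derive_normc (derivableP (dG Dw)) eta0.
have [d d0 Hd] := disk_open Dw.
have m0 : 0 < Num.min r d by rewrite lt_min r0.
near=> n.
have en : e n < Num.min r d.
  near: n; exact: near_infty_natSinv_lt (PosNum m0).
have e0 : 0 < e n by rewrite invr_gt0.
have shE : ((sh n w).1 +i* (sh n w).2 : C) - z = (e n)%:C.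
  by rewrite /sh/z/=; apply/eqP; rewrite eq_complex/= addrAC subrr add0r subrr !eqxx.
have shn : normc (((sh n w).1 +i* (sh n w).2) - z) = e n.
  by rewrite shE /= expr0n addr0 sqrtr_sqr gtr0_norm.
have [Dsh shr] : D (sh n w) /\ normc (((sh n w).1 +i* (sh n w).2) - z) < r.
  by move: en; rewrite -{1}shn lt_min => /andP[h1 h2]; split => //; exact: Hd.
have qE : q n w = normc (G ((sh n w).1 +i* (sh n w).2) - G z) * n.+1%:R.
  rewrite /q /re /im !patchE !mem_set//; congr (_ * _).
  by rewrite -/z; case: (G _) => ? ?; case: (G _) => ? ?.
rewrite qE -/z derive1E.
have -> : normc ('D_1 G z) = normc ('D_1 G z * (e n)%:C) * n.+1%:R.
  rewrite Normc.normcM -shE.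
  by rewrite shn -mulrA mulVf ?mulr1.
rewrite -mulrBl normrM (ger0_norm (_ : 0 <= n.+1%:R))//.
rewrite -ler_pdivlMr// -/(e n).
apply: le_trans (normc_dist _ _) _; rewrite normcB -shE.
by rewrite -shn; exact: Hr.
Unshelve. all: by end_near. Qed.

End PlaneMeasurability.

(** * Energy integrals *)
Section Energy.
Local Open Scope complex_scope.
Variable R : realType.
Local Notation C := (R[i]^o).
Local Notation normc := (@Normc.normc R).
Local Notation plane_disk := [set w : R * R | @disk R (w.1 +i* w.2)].
Local Notation mu2 := ((@lebesgue_measure R) \x (@lebesgue_measure R))%E.
Variables p s : R.
Hypothesis hp : 1 < p.

Definition weight (w : R * R) : R := (1 - normc (w.1 +i* w.2) ^+ 2) `^ (p - 2 + s).

Definition energy (F : C -> C) : \bar R :=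
  (\int[mu2]_(w in plane_disk)
      (normc (derive1 F (w.1 +i* w.2)) `^ p * weight w)%:E)%E.

Let p0 : 0 < p. Proof. exact: lt_trans hp. Qed.

Lemma energy_ge0 F : (0 <= energy F)%E.
Proof. by apply: integral_ge0 => w _; rewrite lee_fin mulr_ge0// powR_ge0. Qed.

Lemma Bp_seminorm_energy F (X : R) : 0 <= X ->
  (Bp_seminorm p s F <= X%:E)%E <-> (energy F <= (X `^ p)%:E)%E.
Proof.
move=> X0; have E0 := energy_ge0 F.
rewrite -[Bp_seminorm p s F]/((energy F `^ p^-1)%E).
have pV0 : 0 <= p^-1 by rewrite invr_ge0 ltW.
have in0 (x : \bar R) : (0 <= x)%E -> x \in `[0%E, +oo%E].
  by move=> x0; rewrite in_itv/= x0 leey.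
split=> H.
- have -> : energy F = ((energy F `^ p^-1) `^ p)%E.
    by rewrite -poweRrM mulVf ?gt_eqF// poweRe1.
  rewrite -poweR_EFin; apply: gt0_ler_poweR; rewrite ?in0 ?poweR_ge0 ?lee_fin//.
  exact: ltW.
- have -> : X%:E = ((X `^ p)%:E `^ p^-1)%E.
    by rewrite poweR_EFin -powRrM mulfV ?gt_eqF// powRr1.
  by apply: gt0_ler_poweR; rewrite ?in0 ?lee_fin ?powR_ge0.
Qed.

Lemma measurable_weight : measurable_fun plane_disk weight.
Proof.
apply: (@measurableT_comp _ _ _ _ _ _ (@powR R ^~ (p - 2 + s))).
  exact: measurable_powR.
apply: measurable_funB => //; apply: measurable_funX.
by apply: (@measurable_normc_disk R id) => z _; exact: derivable_id.
Qed.

Lemma weight_gt0 w : plane_disk w -> 0 < weight w.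
Proof.
rewrite /plane_disk/disk/= => w1; apply: powR_gt0.
rewrite subr_gt0 expr_lt1//; exact: normc_ge0.
Qed.

Lemma measurable_energy_integrand (F : C -> C) : (forall z, disk z -> derivable F z 1) ->
  measurable_fun plane_disk (fun w =>
      (normc (derive1 F (w.1 +i* w.2)) `^ p * weight w)%:E).
Proof.
move=> dF; apply/measurable_EFinP; apply: measurable_funM; last exact: measurable_weight.
apply: (@measurableT_comp _ _ _ _ _ _ (@powR R ^~ p)).
  exact: measurable_powR.
exact: measurable_normc_derive_disk.
Qed.

Lemma powR_le_add (f g h c : R) : 0 <= f -> 0 <= g -> 0 <= h -> 0 <= c ->
  h <= c * (f + g) -> h `^ p <= (2 * c) `^ p * (f `^ p + g `^ p).
Proof.
move=> f0 g0 h0 c0 hfg.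
have m0 : 0 <= Num.max f g by rewrite le_max f0.
apply: (@le_trans _ _ ((2 * c * Num.max f g) `^ p)).
  apply: ge0_ler_powR; rewrite ?nnegrE ?(ltW p0) ?mulr_ge0//.
  apply: le_trans hfg _; rewrite -mulrA mulrCA mulr_natl mulr2n.
  by apply: ler_wpM2l => //; apply: lerD; rewrite le_max lexx ?orbT.
rewrite powRM ?mulr_ge0//; apply: ler_wpM2l; first exact: powR_ge0.
case: (leP f g) => _; first by rewrite lerDr powR_ge0.
by rewrite lerDl powR_ge0.
Qed.

(** The constant 4 is not sharp: convexity is avoided by comparing a sum with
    twice the larger of its terms. *)
Lemma energy_le_add (F G H : C -> C) (c X Y : R) : 0 <= c -> 0 <= X -> 0 <= Y ->
  (forall z, disk z -> derivable F z 1) ->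
  (forall z, disk z -> derivable G z 1) ->
  (forall z, disk z -> derivable H z 1) ->
  (forall z, disk z -> normc (derive1 H z) <=
     c * (normc (derive1 F z) + normc (derive1 G z))) ->
  (Bp_seminorm p s F <= X%:E)%E -> (Bp_seminorm p s G <= Y%:E)%E ->
  (Bp_seminorm p s H <= (4 * c * (X + Y))%:E)%E.
Proof.
move=> c0 X0 Y0 dF dG dH HFG /(Bp_seminorm_energy _ X0) EF /(Bp_seminorm_energy _ Y0) EG.
have mD : measurable plane_disk := @plane_disk_measurable R.
have c20 : 0 <= 2 * c by rewrite mulr_ge0.
apply/Bp_seminorm_energy; first by rewrite !mulr_ge0// addr_ge0.
have mono (x y : R) : 0 <= x -> x <= y -> x `^ p <= y `^ p.
  by move=> x0 xy; apply: ge0_ler_powR; rewrite ?nnegrE ?(ltW p0)//; exact: le_trans xy.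
pose mu2' : {measure set (measurableTypeR R * measurableTypeR R) -> \bar R} := mu2.
pose int (F : C -> C) w := (normc (derive1 F (w.1 +i* w.2)) `^ p * weight w)%:E.
have int0 F' w : (0 <= int F' w)%E by rewrite lee_fin mulr_ge0// powR_ge0.
have mF := measurable_energy_integrand dF.
have mG := measurable_energy_integrand dG.
have mH := measurable_energy_integrand dH.
apply: (@le_trans _ _ (((2 * c) `^ p)%:E * (energy F + energy G))%E).
  have ED : (energy F + energy G = \int[mu2]_(w in plane_disk) (int F w + int G w))%E.
    symmetry; exact: (ge0_integralD mu2' mD (fun w _ => int0 F w) mF (fun w _ => int0 G w) mG).
  have mD2 : measurable_fun plane_disk (fun w => int F w + int G w)%E.
    exact: (emeasurable_funD mF mG).
  have {}ED : (((2 * c) `^ p)%:E * (energy F + energy G) =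
      \int[mu2]_(w in plane_disk) (((2 * c) `^ p)%:E * (int F w + int G w)))%E.
    rewrite ED; symmetry; apply: (ge0_integralZl_EFin mu2' mD _ mD2).
    - by move=> w _; apply: adde_ge0; exact: int0.
    - exact: powR_ge0.
  rewrite ED.
  apply: (ge0_le_integral mu2' mD (fun w _ => int0 H w) mH).
    exact: (measurable_funeM _ mD2).
  move=> w Dw; rewrite -EFinD -EFinM lee_fin -mulrDl mulrA.
  apply: ler_wpM2r; first exact: powR_ge0.
  by apply: powR_le_add; [| | | |exact: HFG]; rewrite ?normc_ge0.
apply: (@le_trans _ _ (((2 * c) `^ p)%:E * (X `^ p + Y `^ p)%:E)%E).
  by apply: lee_wpmul2l; [rewrite lee_fin powR_ge0|rewrite EFinD leeD].
rewrite -EFinM lee_fin.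
have -> : 4 * c * (X + Y) = 2 * c * (2 * (X + Y)) by ring.
rewrite [leRHS]powRM ?mulr_ge0 ?addr_ge0//; apply: ler_wpM2l; first exact: powR_ge0.
rewrite powRM ?addr_ge0//.
apply: (@le_trans _ _ (2 * (X + Y) `^ p)).
  rewrite mulr_natl mulr2n; apply: lerD; apply: mono => //; first by rewrite lerDl.
  by rewrite lerDr.
apply: ler_wpM2r; first exact: powR_ge0.
by rewrite -[leLHS](powRr1 (_ : 0 <= 2))//; apply: ler_powR; [lra|exact: ltW].
Qed.

End Energy.

(** * Functions on the disk that are flat almost everywhere *)
Section DiskConstancy.
Local Open Scope complex_scope.
Variable R : realType.
Local Notation C := (R[i]^o).
Local Notation normc := (@Normc.normc R).
Local Notation mu := (@lebesgue_measure R).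
Local Notation mu2 := ((@lebesgue_measure R) \x (@lebesgue_measure R))%E.

Lemma disk_sumsq (x y : R) : @disk R (x +i* y) <-> x ^+ 2 + y ^+ 2 < 1.
Proof.
have xy0 : 0 <= x ^+ 2 + y ^+ 2 by rewrite addr_ge0 ?sqr_ge0.
by rewrite /disk/= -{1}[1]sqrtr1 ltr_sqrt.
Qed.

(** This is how a property of almost every line reaches, by continuity, all
    lines. *)
Lemma negligible_dense (N : set R) (x d : R) : mu.-negligible N -> 0 < d ->
  exists y, `|y - x| < d /\ ~ N y.
Proof.
move=> N0 d0; apply: contrapT => /forallNP H.
have sub : ball x d `<=` N.
  move=> y; rewrite /ball/= distrC => yx; have := H y.
  by move=> /not_andP[//|/contrapT].
have /negligibleP : mu.-negligible (ball x d) by exact: negligibleS N0.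
move=> /(_ (@open_measurable R _ (ball_open _ _))).
move=> b0; have := lebesgue_measure_ball x (ltW d0); rewrite b0 => /eqP.
by rewrite eqe eq_sym mulrn_eq0/= gt_eqF.
Qed.

Variables (u : C -> R) (B : set C).
Hypothesis u_lip : forall z, disk z -> exists K, exists2 r : R, 0 < r &
  forall w, normc (w - z) < r -> `|u w - u z| <= K * normc (w - z).
Hypothesis u_flat : forall z, disk z -> ~ B z -> forall e : R, 0 < e ->
  exists2 r : R, 0 < r &
    forall w, normc (w - z) < r -> `|u w - u z| <= e * normc (w - z).

Lemma u_continuous z : disk z -> forall e : R, 0 < e ->
  exists2 r : R, 0 < r & forall w, normc (w - z) < r -> `|u w - u z| < e.
Proof.
move=> /u_lip[K [r r0 H]] e e0; pose K' := `|K| + 1.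
have K'0 : 0 < K' by rewrite ltr_wpDl.
exists (Num.min r (e / K')); first by rewrite lt_min r0 divr_gt0.
move=> w; rewrite lt_min => /andP[wr we].
apply: le_lt_trans (H _ wr) _; apply: (@le_lt_trans _ _ (K' * normc (w - z))).
  by apply: ler_wpM2r; [exact: normc_ge0|rewrite /K'; have := ler_norm K; lra].
by rewrite mulrC -ltr_pdivlMr.
Qed.

(** [L x] parametrises the x-th line of one of the two families of lines
    parallel to the axes. *)
Section Line.
Variable L : R -> R -> C.
Hypothesis L_dist : forall x x' t t', normc (L x t - L x' t') <= `|x - x'| + `|t - t'|.
Hypothesis L_disk : forall x t, disk (L x t) <-> x ^+ 2 + t ^+ 2 < 1.
Hypothesis B_line : mu.-negligible [set x | ~ mu.-negligible [set t | B (L x t)]].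

Lemma good_line_cst (x a b : R) : a <= b -> mu.-negligible [set t | B (L x t)] ->
  disk (L x a) -> disk (L x b) -> u (L x a) = u (L x b).
Proof.
move=> ab Bx Da Db.
have Dt t : a <= t <= b -> disk (L x t).
  move=> /andP[at_ tb]; move: Da Db; rewrite !L_disk.
  have [t0|t0] := leP 0 t.
    have : t ^+ 2 <= b ^+ 2 by apply: lerXn2r; rewrite ?nnegrE; lra.
    lra.
  have : (- t) ^+ 2 <= (- a) ^+ 2 by apply: lerXn2r; rewrite ?nnegrE; lra.
  rewrite !sqrrN; lra.
have line t r : 0 < r -> \forall y \near t, normc (L x y - L x t) < r.
  move=> r0; apply/nbhs_ballP; exists r => // y; rewrite /ball/= distrC => yt.
  by apply: le_lt_trans (L_dist _ _ _ _) _; rewrite subrr normr0 add0r.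
have Ldist t y : normc (L x y - L x t) <= `|y - t|.
  by apply: le_trans (L_dist _ _ _ _) _; rewrite subrr normr0 add0r.
apply: (@ae_flat_cst _ (u \o L x) _ _ _ ab Bx) => t /Dt tD.
- have [K [r r0 H]] := u_lip tD; exists `|K|.
  apply: filterS (line t r r0) => y /H /= /le_trans; apply.
  apply: (@le_trans _ _ (`|K| * normc (L x y - L x t))).
    by apply: ler_wpM2r; [exact: normc_ge0|exact: ler_norm].
  exact: ler_wpM2l.
- move=> /= nB e e0; have [r r0 H] := u_flat tD nB e0.
  apply: filterS (line t r r0) => y /H /= /le_trans; apply.
  by apply: ler_wpM2l => //; exact: ltW.
Qed.

Lemma line_cst (x a b : R) : disk (L x a) -> disk (L x b) -> u (L x a) = u (L x b).
Proof.
wlog ab : a b / a <= b.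
  by move=> H Da Db; have [ab|/ltW ba] := leP a b; [|symmetry]; exact: H.
move=> Da Db; apply/eqP; rewrite -subr_eq0 -normr_le0; apply/ler_addgt0Pr => e e0.
rewrite add0r.
have e20 : 0 < e / 2 by rewrite divr_gt0.
have [r1 r10 H1] := u_continuous Da e20.
have [r2 r20 H2] := u_continuous Db e20.
have [r3 r30 H3] := disk_open Da.
have [r4 r40 H4] := disk_open Db.
pose r := Num.min (Num.min r1 r2) (Num.min r3 r4).
have r0 : 0 < r by rewrite !lt_min r10 r20 r30.
have [y [yx /= /contrapT Ny]] := negligible_dense x B_line r0.
have near t : normc (L y t - L x t) < r.
  by apply: le_lt_trans (L_dist _ _ _ _) _; rewrite subrr normr0 addr0.
have := near a; rewrite !lt_min => /andP[/andP[a1 _] /andP[a3 _]].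
have := near b; rewrite !lt_min => /andP[/andP[_ b2] /andP[_ b4]].
have := good_line_cst ab Ny (H3 _ a3) (H4 _ b4).
have := H1 _ a1; have := H2 _ b2; set ya := u (L y a); set yb := u (L y b).
move=> h1 h2 yab; rewrite yab in h2.
have := ler_distD yb (u (L x a)) (u (L x b)); rewrite (distrC _ yb).
lra.
Qed.

End Line.

Hypothesis mB : measurable [set w : R * R | B (w.1 +i* w.2)].
Hypothesis B0 : mu2 [set w : R * R | B (w.1 +i* w.2)] = 0%E.

Lemma section_negligible (S : R -> set R) :
  (forall x, measurable (S x)) -> measurable_fun setT (mu \o S) ->
  (\int[mu]_x (mu (S x)) = 0)%E ->
  mu.-negligible [set x | ~ mu.-negligible (S x)].
Proof.
move=> mS mf I0.
have : (\int[mu]_x `|(mu \o S) x| = 0)%E.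
  by rewrite -[RHS]I0; apply: eq_integral => x _; rewrite gee0_abs.
move=> /(ae_eq_integral_abs mu measurableT mf) .
apply: negligibleS => x /= Sx H; by apply: Sx; apply/negligibleP; [exact: mS|exact: H].
Qed.

Lemma ae_flat_disk_cst z : disk z -> u z = u 0.
Proof.
case: z => x y Dxy.
pose E := [set w : R * R | B (w.1 +i* w.2)].
have Dx0 : disk (x +i* 0 : C).
  by move: Dxy; rewrite !disk_sumsq expr0n/= addr0; have := sqr_ge0 y; lra.
have D0 : disk (0 +i* 0 : C) by rewrite disk_sumsq expr0n/= addr0 ltr01.
transitivity (u (x +i* 0)).
  apply: (@line_cst (fun x t => x +i* t)) => //.
  - move=> a a' t t'; apply: le_trans (normc_le_add _ _) _; lra.
  - by move=> a t; exact: disk_sumsq.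
  - have xE a : [set t | B (a +i* t)] = xsection E a.
      by apply/seteqP; split => t; rewrite /xsection/= inE.
    under eq_set => a do rewrite xE.
    apply: (@section_negligible (xsection E)).
    + by move=> a; exact: measurable_xsection.
    + exact: (measurable_fun_xsection mu mB).
    + exact: B0.
apply: (@line_cst (fun y t => t +i* y)) => //.
- by move=> a a' t t'; apply: le_trans (normc_le_add _ _) _; rewrite addrC.
- by move=> a t; rewrite addrC; exact: disk_sumsq.
- have yE a : [set t | B (t +i* a)] = ysection E a.
    by apply/seteqP; split => t; rewrite /ysection/= inE.
  under eq_set => a do rewrite yE.
  apply: (@section_negligible (ysection E)).
  + by move=> a; exact: measurable_ysection.
  + exact: (measurable_fun_ysection mu mB).
  + rewrite -[RHS]B0; symmetry.
    apply: (@product_measure_unique _ _ _ _ R mu mu (mu \x^ mu)%E) => //.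
    by move=> A1 A2 mA1 mA2; exact: product_measure2E.
Qed.

End DiskConstancy.

(** * A function whose powers have geometrically bounded seminorms is bounded *)
Section LevelSet.
Local Open Scope complex_scope.
Variable R : realType.
Local Notation C := (R[i]^o).
Local Notation normc := (@Normc.normc R).
Local Notation plane_disk := [set w : R * R | @disk R (w.1 +i* w.2)].
Local Notation mu2 := ((@lebesgue_measure R) \x (@lebesgue_measure R))%E.

Lemma geometric_le0 (a b i : R) : 0 < b -> b < a ->
  (forall m, a ^+ m * i <= b ^+ m.+1) -> i <= 0.
Proof.
move=> b0 ba H; have a0 : 0 < a := lt_trans b0 ba.
rewrite leNgt; apply/negP => i0.
have q1 : `|b / a| < 1 by rewrite ger0_norm ?divr_ge0 ?ltW// ltr_pdivrMr// mul1r.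
have /cvgrPdist_lt/(_ i i0)[m _ /(_ m)] := cvg_geometric b q1.
rewrite /= leqnn sub0r normrN => /(_ isT).
rewrite ger0_norm; last by rewrite mulr_ge0 ?exprn_ge0 ?divr_ge0 ?ltW.
rewrite expr_div_n mulrA -exprS ltr_pdivrMr ?exprn_gt0// mulrC.
by rewrite ltNge H.
Qed.

Lemma powR_exp (a p : R) m : 0 <= a -> (a ^+ m) `^ p = (a `^ p) ^+ m.
Proof. by move=> a0; rewrite -!powR_mulrn ?powR_ge0// -!powRrM mulrC. Qed.

Variables (p s : R) (k : C -> C) (g : nat -> C -> C) (M r : R).
Hypothesis hp : 1 < p.
Hypothesis dk : forall z, disk z -> derivable k z 1.
Hypothesis gk : forall n z, disk z -> g n z = k z ^+ n.
Hypothesis M0 : 0 < M.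
Hypothesis gM : forall n, (Bp_seminorm p s (g n) <= (M ^+ n)%:E)%E.
Hypothesis Mr : M < r.

Definition moving_set : set C :=
  [set z | [/\ disk z, r < normc (k z) & 0 < normc (derive1 k z)]].

Lemma moving_set_measurable : measurable [set w : R * R | moving_set (w.1 +i* w.2)].
Proof.
have mD := @plane_disk_measurable R.
have -> : [set w : R * R | moving_set (w.1 +i* w.2)] =
  (plane_disk `&` (fun w : R * R => normc (k (w.1 +i* w.2))) @^-1` `]r, +oo[) `&`
  (plane_disk `&` (fun w : R * R => normc (derive1 k (w.1 +i* w.2))) @^-1` `]0, +oo[).
  apply/seteqP; split => w /=; rewrite !in_itv/= !andbT.
    by case.
  by move=> [[? ?] [_ ?]].
apply: measurableI.
  exact: (measurable_normc_disk dk mD (measurable_itv _)).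
exact: (measurable_normc_derive_disk dk mD (measurable_itv _)).
Qed.

Lemma power_derive n z : disk z ->
  is_derive z 1 (g n.+1) (n.+1%:R * k z ^+ n * derive1 k z).
Proof.
move=> Dz; have kd : is_derive z 1 k (derive1 k z).
  by rewrite derive1E; exact: derivableP (dk Dz).
apply: (near_eq_is_derive _ (is_derive_expr n kd)).
have [d d0 H] := disk_open Dz.
by apply/nbhs_normcP; exists d => // w /H Dw; rewrite gk.
Qed.

(** On the moving set the derivative of k^(m+1) has modulus at least
    r^m |k'|, so the energy I of k over that set satisfies
    r^(p m) I <= M^(p (m+1)) for all m, which forces I = 0; and the integrand is
    positive there. *)
Lemma moving_set_null : mu2 [set w : R * R | moving_set (w.1 +i* w.2)] = 0%E.
Proof.
have r0 : 0 < r := lt_trans M0 Mr.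
have p0 : 0 < p := lt_trans ltr01 hp.
set E := [set w : R * R | _].
have mE : measurable E := moving_set_measurable.
have mD := @plane_disk_measurable R.
have ED : E `<=` plane_disk by move=> w [].
pose m2 : {measure set (measurableTypeR R * measurableTypeR R) -> \bar R} := mu2.
pose int (F : C -> C) (w : R * R) :=
  (normc (derive1 F (w.1 +i* w.2)) `^ p * weight p s w)%:E.
have int0 F w : (0 <= int F w)%E by rewrite lee_fin mulr_ge0// powR_ge0.
have mint F : (forall z, disk z -> derivable F z 1) -> measurable_fun plane_disk (int F).
  exact: measurable_energy_integrand.
have mk : measurable_fun E (int k) := measurable_funS mD ED (mint k dk).
have dg n z : disk z -> derivable (g n.+1) z 1.
  by move=> Dz; have [] := power_derive n Dz.
pose I := (\int[m2]_(w in E) int k w)%E.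
have I0 : (0 <= I)%E by apply: integral_ge0 => w _; exact: int0.
have key m : (((r ^+ m) `^ p)%:E * I <= (((M ^+ m.+1)) `^ p)%:E)%E.
  have /(Bp_seminorm_energy s hp _ (exprn_ge0 _ (ltW M0))) := gM m.+1.
  apply: le_trans.
  have mg := mint _ (dg m).
  have mgE := measurable_funS mD ED mg.
  apply: (@le_trans _ _ (\int[m2]_(w in E) int (g m.+1) w)%E); last first.
    exact: (ge0_subset_integral m2 mE mD mg (fun w _ => int0 _ w) ED).
  rewrite -(ge0_integralZl_EFin m2 mE (fun w _ => int0 k w) mk (powR_ge0 _ _)).
  apply: (ge0_le_integral m2 mE _ (measurable_funeM _ mk) mgE) => w Ew.
    by rewrite mule_ge0// lee_fin powR_ge0.
  have [Dw rk k0] := Ew.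
  rewrite /int -EFinM lee_fin mulrA; apply: ler_wpM2r; first exact: powR_ge0.
  rewrite (is_derive_derive1 (power_derive m Dw)) !Normc.normcM normc_nat normcX.
  rewrite -powRM ?exprn_ge0 ?normc_ge0 ?(ltW r0)//.
  apply: ge0_ler_powR; rewrite ?nnegrE ?mulr_ge0 ?exprn_ge0 ?normc_ge0 ?ler0n ?(ltW r0) ?(ltW p0)//.
  apply: ler_wpM2r; first exact: normc_ge0.
  apply: (@le_trans _ _ (normc (k (w.1 +i* w.2)) ^+ m)).
    by apply: lerXn2r; rewrite ?nnegrE ?normc_ge0 ?(ltW r0) ?(ltW rk).
  by rewrite ler_peMl ?exprn_ge0 ?normc_ge0// ler1n.
have Ifin : I \is a fin_num.
  rewrite ge0_fin_numE//; have := key 0; rewrite expr0 powR1 mul1e => /le_lt_trans; apply.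
  exact: ltry.
have Iz : I = 0%E.
  apply/eqP; rewrite eq_le I0 andbT -(fineK Ifin) lee_fin.
  apply: (@geometric_le0 (r `^ p) (M `^ p)); first exact: powR_gt0.
    by apply: gt0_ltr_powR; rewrite ?nnegrE ?ltW.
  move=> m; rewrite -!powR_exp ?(ltW r0) ?(ltW M0)//; have := key m.
  by rewrite -{1}(fineK Ifin) -EFinM lee_fin.
have : (\int[m2]_(w in E) `|int k w| = 0)%E.
  by rewrite -[RHS]Iz; apply: eq_integral => w _; rewrite (gee0_abs (int0 _ _)).
move=> /(ae_eq_integral_abs m2 mE mk) EN.
apply/negligibleP => //; apply: negligibleS EN => w Ew /= H.
have [Dw _ k0] := Ew.
have := H Ew; rewrite /int => -[] /eqP; rewrite gt_eqF// mulr_gt0//.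
  exact: powR_gt0.
exact: weight_gt0.
Qed.

(** The square of the excess is flat wherever |k| <= r, and, unlike the excess
    itself, it is flat also on the boundary |k| = r. *)
Definition excess (z : C) : R := Num.max 0 (normc (k z) - r).

Lemma excess_sq_dist z w : `|excess w ^+ 2 - excess z ^+ 2| <=
  normc (k w - k z) * (2 * excess z + normc (k w - k z)).
Proof.
have mz : 0 <= excess z by rewrite le_max lexx.
have mw : 0 <= excess w by rewrite le_max lexx.
have d : `|excess w - excess z| <= normc (k w - k z).
  apply: le_trans (normc_dist _ _); rewrite /excess.
  case: (lerP 0 (normc (k w) - r)) => hw; case: (lerP 0 (normc (k z) - r)) => hz.
  - by rewrite opprB addrA subrK.
  - by rewrite subr0 !ger0_norm; lra.
  - by rewrite sub0r normrN ger0_norm// ler0_norm; lra.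
  - by rewrite subrr normr0.
rewrite subr_sqr normrM; apply: ler_pM => //.
rewrite ger0_norm ?addr_ge0//; have := ler_norm (excess w - excess z); lra.
Qed.

Lemma excess_sq_lip z : disk z -> exists K, exists2 d : R, 0 < d &
  forall w, normc (w - z) < d ->
    `|excess w ^+ 2 - excess z ^+ 2| <= K * normc (w - z).
Proof.
move=> Dz; have mz : 0 <= excess z by rewrite le_max lexx.
have [K [K0 [d d0 H]]] := derivable_lipschitz (dk Dz).
exists (K * (2 * excess z + K)), (Num.min d 1); first by rewrite lt_min d0/=.
move=> w; rewrite lt_min => /andP[wd w1].
apply: le_trans (excess_sq_dist _ _) _.
have Hw := H _ wd; rewrite mulrAC; apply: ler_pM => //; first exact: normc_ge0.
  by rewrite addr_ge0 ?mulr_ge0 ?normc_ge0.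
rewrite lerD2l; apply: le_trans Hw _; rewrite -[leRHS]mulr1.
by apply: ler_wpM2l; exact: ltW.
Qed.

(** Where |k| <= r, the square is quadratic in |k w - k z| = O (|w - z|); where
    |k| > r, the derivative of k vanishes outside the moving set. *)
Lemma excess_sq_flat z : disk z -> ~ moving_set z -> forall e : R, 0 < e ->
  exists2 d : R, 0 < d & forall w, normc (w - z) < d ->
    `|excess w ^+ 2 - excess z ^+ 2| <= e * normc (w - z).
Proof.
move=> Dz nB e e0; have mz : 0 <= excess z by rewrite le_max lexx.
have [rk|kr] := ltP r (normc (k z)); last first.
  have ez : excess z = 0.
    by rewrite /excess; apply/max_idPl; rewrite subr_le0.
  have [K [K0 [d d0 H]]] := derivable_lipschitz (dk Dz).
  have K2 : 0 < K * K by rewrite mulr_gt0.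
  exists (Num.min d (e / (K * K))); first by rewrite lt_min d0 divr_gt0.
  move=> w; rewrite lt_min => /andP[wd we].
  apply: le_trans (excess_sq_dist _ _) _; rewrite ez mulr0 add0r.
  have Hw := H _ wd.
  apply: (@le_trans _ _ ((K * normc (w - z)) * (K * normc (w - z)))).
    by apply: ler_pM => //; exact: normc_ge0.
  rewrite mulrACA mulrA; apply: ler_wpM2r; first exact: normc_ge0.
  by rewrite mulrC -ler_pdivlMr// ltW.
have k0 : derive1 k z = 0.
  apply: contrapT => /eqP nz; apply: nB; split => //; exact: normc_gt0.
have kd : is_derive z 1 k 0.
  by rewrite -k0 derive1E; exact: derivableP (dk Dz).
pose c := 2 * excess z + 1.
have c0 : 0 < c by rewrite ltr_wpDl ?mulr_ge0.
have e10 : 0 < Num.min 1 (e / c) by rewrite lt_min ltr01 divr_gt0.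
have [d d0 H] := is_derive_normc kd e10.
exists (Num.min d 1); first by rewrite lt_min d0/=.
move=> w; rewrite lt_min => /andP[wd w1].
have := H _ wd; rewrite mul0r subr0 => Hw.
apply: le_trans (excess_sq_dist _ _) _.
have n0 := normc_ge0 (w - z).
have Hw1 : normc (k w - k z) <= 1.
  apply: le_trans Hw _; rewrite -[leRHS]mulr1; apply: ler_pM => //; rewrite ?(ltW e10) ?(ltW w1)//.
  by rewrite ge_min lexx.
have Hwe : normc (k w - k z) <= e / c * normc (w - z).
  by apply: le_trans Hw _; apply: ler_wpM2r => //; rewrite ge_min lexx orbT.
apply: (@le_trans _ _ (e / c * normc (w - z) * c)).
  apply: ler_pM => //; rewrite ?addr_ge0 ?mulr_ge0 ?normc_ge0//.
  by rewrite /c lerD2l.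
by rewrite mulrAC divfK ?gt_eqF.
Qed.

Lemma power_energy_bound : normc (k 0) <= M -> forall z, disk z -> normc (k z) <= r.
Proof.
move=> kM z Dz.
have := ae_flat_disk_cst excess_sq_lip excess_sq_flat moving_set_measurable moving_set_null Dz.
have -> : excess 0 = 0.
  by rewrite /excess; apply/max_idPl; rewrite subr_le0 (le_trans kM)// ltW.
rewrite expr0n/= => /eqP; rewrite sqrf_eq0 => /eqP ez.
by rewrite -subr_le0 -ez le_max lexx orbT.
Qed.

End LevelSet.

(** * The space and its multipliers *)
Section QspSpace.
Local Open Scope complex_scope.
Variable R : realType.
Local Notation C := (R[i]^o).
Local Notation normc := (@Normc.normc R).
Local Notation plane_disk := [set w : R * R | @disk R (w.1 +i* w.2)].
Local Notation mu2 := ((@lebesgue_measure R) \x (@lebesgue_measure R))%E.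

Lemma normcV (z : C) : normc z^-1 = (normc z)^-1.
Proof. exact: Normc.normcV. Qed.

Lemma normc_opp (z : C) : normc (- z) = normc z.
Proof. by apply: complexI; rewrite -!normE normrN. Qed.

Lemma normc_sumsq (z : C) : normc z ^+ 2 = complex.Re z ^+ 2 + complex.Im z ^+ 2.
Proof. by case: z => a b /=; rewrite sqr_sqrtr// addr_ge0 ?sqr_ge0. Qed.

Lemma disk0 : disk (0 : C).
Proof. by rewrite /disk/= expr0n/= addr0 sqrtr0 ltr01. Qed.

(** The difference of the squares of both sides is (1 - |a|^2) (1 - |z|^2). *)
Lemma disk_aut_dist (a z : C) : disk a -> disk z ->
  normc (a - z) < normc (1 - a^* * z).
Proof.
rewrite /disk/= => a1 z1.
have sq1 (w : C) : normc w < 1 -> normc w ^+ 2 < 1.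
  by move=> w1; rewrite expr_lt1// normc_ge0.
rewrite -(ltr_pXn2r (_ : 0 < 2)%N) ?nnegrE ?normc_ge0//.
have := sq1 _ a1; have := sq1 _ z1; rewrite !normc_sumsq.
case: a {a1} => x y; case: z {z1} => u v /= h1 h2.
have : 0 < (1 - (x ^+ 2 + y ^+ 2)) * (1 - (u ^+ 2 + v ^+ 2)).
  by apply: mulr_gt0; rewrite subr_gt0.
nra.
Qed.

Lemma disk_aut_denom (a z : C) : disk a -> disk z -> 1 - a^* * z != 0.
Proof.
move=> Da Dz; apply/eqP => d0; have := disk_aut_dist Da Dz.
by rewrite d0 Normc.normc0 ltNge normc_ge0.
Qed.

Lemma disk_aut_disk (a z : C) : disk a -> disk z -> disk (disk_aut a z).
Proof.
move=> Da Dz; rewrite /disk /disk_aut/= Normc.normcM normcV ltr_pdivrMr ?mul1r.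
  exact: disk_aut_dist.
exact/normc_gt0/disk_aut_denom.
Qed.

Lemma disk_aut_derivable (a z : C) : disk a -> disk z -> derivable (disk_aut a) z 1.
Proof.
move=> Da Dz.
have Did : is_derive z 1 (id : C -> C) 1 by exact: is_derive_id.
have Dcst (c : C) : is_derive z 1 (fun=> c : C) 0 by exact: is_derive_cst.
have Dlin (c d : C) : is_derive z 1 (fun w : C => c + d * w) (0 + (d * 1 + z * 0)).
  by apply: is_derive_add => //; exact: is_derive_mul.
have D1 := Dlin a (-1); have D2 := Dlin 1 (- a^*).
have den : (fun w : C => 1 + - a^* * w) z != 0.
  by rewrite mulNr; exact: disk_aut_denom.
have D3 := is_derive_comp D2 (is_derive_inv den).
have [D4 _] := is_derive_mul D1 D3.
have -> : disk_aut a = (fun w : C => (a + -1 * w) * (1 + - a^* * w)^-1).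
  by apply/funext => w; rewrite /disk_aut mulN1r mulNr.
exact: D4.
Qed.

Lemma derivable_is_derive (F : C -> C) z : derivable F z 1 -> is_derive z 1 F (derive1 F z).
Proof. by rewrite derive1E; exact: derivableP. Qed.

Lemma comp_disk_aut_derivable (F : C -> C) (a : C) :
  (forall z, disk z -> derivable F z 1) -> disk a ->
  forall z, disk z -> derivable (F \o disk_aut a) z 1.
Proof.
move=> dF Da z Dz.
have D1 := derivable_is_derive (disk_aut_derivable Da Dz).
have D2 := derivable_is_derive (dF _ (disk_aut_disk Da Dz)).
by have [] := is_derive_comp D1 D2.
Qed.

Lemma disk_eq_derive (F G : C -> C) z d : (forall w, disk w -> F w = G w) ->
  disk z -> is_derive z 1 F d -> is_derive z 1 G d.
Proof.
move=> FG Dz; apply: near_eq_is_derive; have [r r0 H] := disk_open Dz.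
by apply/nbhs_normcP; exists r => // w /H /FG.
Qed.

Variables p s : R.
Hypothesis hp : 1 < p.
Local Notation X := (@Qsp R p s).
Local Notation N := (@Qsp_norm R p s).

Lemma Qsp_seminorm_ge0 (F : C -> C) : (0 <= Qsp_seminorm p s F)%E.
Proof.
apply: le_trans (ereal_sup_ubound _); last by exists 0; [exact: disk0|].
exact: poweR_ge0.
Qed.

Lemma Qsp_seminormE (F : C -> C) : X F -> Qsp_seminorm p s F = (fine (Qsp_seminorm p s F))%:E.
Proof. by move=> [_ Foo]; rewrite fineK// ge0_fin_numE// Qsp_seminorm_ge0. Qed.

Lemma fine_seminorm_ge0 (F : C -> C) : 0 <= fine (Qsp_seminorm p s F).
Proof. exact/fine_ge0/Qsp_seminorm_ge0. Qed.

Lemma Qsp_norm_ge0 F : 0 <= N F.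
Proof. by rewrite addr_ge0 ?normc_ge0 ?fine_seminorm_ge0. Qed.

Lemma Bp_le_seminorm (F : C -> C) a : X F -> disk a ->
  (Bp_seminorm p s (F \o disk_aut a) <= (fine (Qsp_seminorm p s F))%:E)%E.
Proof.
by move=> XF Da; rewrite -(Qsp_seminormE XF); apply: ereal_sup_ubound; exists a.
Qed.

Lemma Qsp_of_bound (F : C -> C) (c : R) : analytic_on_disk F ->
  (forall a, disk a -> (Bp_seminorm p s (F \o disk_aut a) <= c%:E)%E) ->
  X F /\ fine (Qsp_seminorm p s F) <= c.
Proof.
move=> aF Fc.
have le : (Qsp_seminorm p s F <= c%:E)%E by apply: ge_ereal_sup => _ [a Da <-]; exact: Fc.
have XF : X F by split => //; apply: le_lt_trans le (ltry _).
by split => //; rewrite -lee_fin -Qsp_seminormE.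
Qed.

(** The unit of the space of functions extended by 0. *)
Definition disk_one (z : C) : C := if pselect (disk z) then 1 else 0.

Lemma disk_oneE z : disk z -> disk_one z = 1.
Proof. by rewrite /disk_one; case: pselect. Qed.

Lemma disk_one_Qsp : X disk_one /\ N disk_one = 1.
Proof.
have one1 z : disk z -> is_derive z 1 disk_one 0.
  move=> Dz; apply: (@disk_eq_derive (fun=> 1)) => // w Dw.
  by rewrite disk_oneE.
have aone : analytic_on_disk disk_one.
  split=> [z|z /one1[]//]; by rewrite /disk_one; case: pselect.
have [] := @Qsp_of_bound disk_one 0 aone.
  move=> a Da; apply/Bp_seminorm_energy => //.
  rewrite powR0 ?gt_eqF ?(lt_trans ltr01)// /energy.
  rewrite integral0_eq// => w Dw.
  have D1 : is_derive (w.1 +i* w.2 : C) 1 (disk_one \o disk_aut a) 0.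
    apply: (@disk_eq_derive (fun=> 1)) => // z Dz.
    by rewrite /= disk_oneE//; exact: disk_aut_disk.
  rewrite (is_derive_derive1 D1) Normc.normc0 powR0 ?mul0r//.
  by rewrite gt_eqF// (lt_trans ltr01).
move=> X1 le0; split => //.
rewrite /Qsp_norm disk_oneE; last exact: disk0.
rewrite Normc.normc1 (_ : fine _ = 0) ?addr0//.
by apply/eqP; rewrite eq_le le0 fine_seminorm_ge0.
Qed.

(** The derivative of [phi] is eliminated in favour of that of [phi * G], so that
    the bound involves neither it nor the size of [phi]. *)
Lemma quotient_derive_bound (phi G : C -> C) (l z : C) (delta : R) :
  0 < delta -> derivable phi z 1 -> derivable G z 1 ->
  delta <= normc (phi z - l) ->
  derivable (fun w => (phi w - l)^-1 * G w) z 1 /\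
  normc (derive1 (fun w => (phi w - l)^-1 * G w) z) <=
    (delta^-1 ^+ 2 * (1 + normc l) + 2 * delta^-1) *
    (normc (derive1 (fun w => phi w * G w) z) + normc (derive1 G z)).
Proof.
move=> d0 /derivable_is_derive dphi /derivable_is_derive dG dl.
have dP := is_derive_mul dphi dG.
have dcst : is_derive z 1 (fun=> - l : C) 0 by exact: is_derive_cst.
have psi0 : phi z - l != 0.
  by apply/eqP => e; move: dl; rewrite e Normc.normc0 leNgt d0.
have dinv := is_derive_comp (is_derive_add dphi dcst) (is_derive_inv psi0).
have dH := is_derive_mul dinv dG.
split; first by case: dH.
rewrite (is_derive_derive1 dH) (is_derive_derive1 dP) /=.
set u := derive1 phi z; set v := derive1 G z.
set P := phi z * v + G z * u.
set w := (phi z - l)^-1.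
have -> : w * v + G z * (- (phi z - l) ^- 2 * (u + 0)) =
    (2 * w + l * w ^+ 2) * v + - (w ^+ 2 * P).
  by rewrite /P /w; field.
have wd : normc w <= delta^-1.
  by rewrite normcV lef_pV2 ?posrE// (lt_le_trans d0).
have w0 := normc_ge0 w; have l0 := normc_ge0 l.
have w2d : normc w ^+ 2 <= delta^-1 ^+ 2.
  by apply: lerXn2r; rewrite ?nnegrE// invr_ge0 ltW.
have dV0 : 0 <= delta^-1 by rewrite invr_ge0 ltW.
apply: le_trans (normcD_le _ _) _.
rewrite normc_opp (Normc.normcM _ v) (Normc.normcM _ P) normcX.
have P0 := normc_ge0 P; have v0 := normc_ge0 v.
have h1 : normc (2 * w + l * w ^+ 2) <= 2 * delta^-1 + normc l * delta^-1 ^+ 2.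
  apply: le_trans (normcD_le _ _) _; rewrite (Normc.normcM _ w) (Normc.normcM l) normcX normc_nat.
  by apply: lerD; apply: ler_wpM2l.
have dd0 := sqr_ge0 delta^-1.
apply: (@le_trans _ _ ((2 * delta^-1 + normc l * delta^-1 ^+ 2) * normc v + delta^-1 ^+ 2 * normc P)).
  by apply: lerD; apply: ler_wpM2r.
have e1 : 0 <= (2 * delta^-1 + normc l * delta^-1 ^+ 2) * normc P.
  by rewrite mulr_ge0// addr_ge0 ?mulr_ge0.
have e2 : 0 <= delta^-1 ^+ 2 * normc v by rewrite mulr_ge0.
lra.
Qed.

Variable f : C -> C.
Hypothesis hf : bounded_operator X N (mul_operator f).

(** The symbol is, on the disk, its product with the unit. *)
Lemma symbol_derivable z : disk z -> derivable f z 1.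
Proof.
move=> Dz; have [fX _ _] := hf; have [X1 _] := disk_one_Qsp.
have [[_ /(_ z Dz) /derivable_is_derive d1] _] := fX _ X1.
have ff w : disk w -> mul_operator f disk_one w = f w.
  by move=> Dw; rewrite /mul_operator disk_oneE// mulr1.
by have [] := disk_eq_derive ff Dz d1.
Qed.

Lemma invertible_of_far (l : C) (delta : R) : 0 < delta ->
  (forall z, disk z -> delta <= normc (f z - l)) ->
  invertible_operator X N (fun g => mul_operator f g - l *: g).
Proof.
move=> d0 far.
have nz z : disk z -> f z - l != 0.
  by move=> /far dl; apply/eqP => e; move: dl; rewrite e Normc.normc0 leNgt d0.
pose S (g : C -> C) : C -> C := fun z => (f z - l)^-1 * g z.
have [fX _ [M fM]] := hf.
pose c := delta^-1 ^+ 2 * (1 + normc l) + 2 * delta^-1.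
have dV0 : 0 <= delta^-1 by rewrite invr_ge0 ltW.
have c0 : 0 <= c by rewrite addr_ge0 ?mulr_ge0 ?addr_ge0 ?normc_ge0.
have SX g : X g -> X (S g) /\ fine (Qsp_seminorm p s (S g)) <=
    4 * c * (fine (Qsp_seminorm p s (mul_operator f g)) + fine (Qsp_seminorm p s g)).
  move=> Xg; have Xfg := fX _ Xg; have [[g0 dg] _] := Xg; have [[_ dfg] _] := Xfg.
  have dSg z : disk z -> derivable (S g) z 1.
    move=> Dz; exact: (quotient_derive_bound d0 (symbol_derivable Dz) (dg _ Dz) (far _ Dz)).1.
  apply: Qsp_of_bound; first by split=> // z /g0 gz; rewrite /S gz mulr0.
  move=> a Da.
  apply: (energy_le_add hp c0 (fine_seminorm_ge0 _) (fine_seminorm_ge0 _)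
    (comp_disk_aut_derivable dfg Da) (comp_disk_aut_derivable dg Da)
    (comp_disk_aut_derivable dSg Da) _ (Bp_le_seminorm Xfg Da) (Bp_le_seminorm Xg Da)).
  move=> z Dz.
  exact: (quotient_derive_bound d0 (comp_disk_aut_derivable symbol_derivable Da Dz)
    (comp_disk_aut_derivable dg Da Dz) (far _ (disk_aut_disk Da Dz))).2.
exists S; split.
  split.
  - by move=> g /SX[].
  - move=> b x y _ _; apply/funext => z.
    rewrite /S -[(b *: x + y) z]/(b * x z + y z).
    rewrite -[RHS]/(b * ((f z - l)^-1 * x z) + (f z - l)^-1 * y z); ring.
  - exists (delta^-1 + 4 * c * (M + 1)) => g Xg.
    have [_ Sg] := SX _ Xg; rewrite mulrDl; apply: lerD.
      rewrite Normc.normcM normcV; apply: ler_pM; rewrite ?invr_ge0 ?normc_ge0//.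
        by rewrite lef_pV2 ?posrE ?(lt_le_trans d0)//; exact: far disk0.
      by rewrite lerDl fine_seminorm_ge0.
    apply: le_trans Sg _; rewrite -[leRHS]mulrA; apply: ler_wpM2l; first by rewrite mulr_ge0.
    rewrite mulrDl mul1r; apply: lerD; last by rewrite lerDr normc_ge0.
    by apply: le_trans (fM _ Xg); rewrite lerDr normc_ge0.
move=> g [[g0 _] _]; have E (w : C) (z : C) (h : C -> C) : (mul_operator f h - l *: h) z = (f z - l) * h z.
  by rewrite -[LHS]/(f z * h z - l * h z) mulrBl.
split; apply/funext => z; have [Dz|nDz] := pselect (disk z).
- by rewrite /S E// mulKf ?nz.
- by rewrite /S E// g0// !mulr0.
- by rewrite E// /S mulVKf ?nz.
- by rewrite E// /S g0// !mulr0.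
Qed.

(** The iterates S^n 1 are the powers of h = S 1 = 1 / (f - l), of norm at most
    M^n; the bound on powers applies to h composed with [disk_aut 0], which is
    z |-> - z. *)
Lemma invertible_far (l : C) :
  invertible_operator X N (fun g => mul_operator f g - l *: g) ->
  exists2 delta : R, 0 < delta & forall z, disk z -> delta <= normc (f z - l).
Proof.
move=> [S [[SX _ [M' SM']] ST]].
pose M := `|M'| + 1.
have M0 : 0 < M by rewrite ltr_wpDl.
have SM g : X g -> N (S g) <= M * N g.
  move=> /SM' /le_trans; apply; apply: ler_wpM2r; first exact: Qsp_norm_ge0.
  by rewrite /M; have := ler_norm M'; lra.
have [X1 N1] := disk_one_Qsp.
pose h n := iter n S disk_one.
have hX n : X (h n) by elim: n => [|n IH]; [exact: X1|exact: SX IH].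
have hN n : N (h n) <= M ^+ n.
  elim: n => [|n IH]; first by rewrite /= N1.
  by apply: le_trans (SM _ (hX n)) _; rewrite exprS ler_pM2l.
have hS n z : (f z - l) * h n.+1 z = h n z.
  have [_ /(congr1 (fun u => u z))] := ST _ (hX n).
  by rewrite -[(_ - _) z]/(f z * h n.+1 z - l * h n.+1 z) -mulrBl.
have h1 z : disk z -> (f z - l) * h 1%N z = 1.
  by move=> Dz; rewrite hS /h/= disk_oneE.
have nz z : disk z -> f z - l != 0.
  by move=> /h1 e; apply/eqP => e0; move: e => /eqP; rewrite e0 mul0r eq_sym oner_eq0.
have hpow n z : disk z -> h n z = h 1%N z ^+ n.
  move=> Dz; elim: n => [|n IH]; first by rewrite /h/= disk_oneE.
  apply: (mulfI (nz _ Dz)).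
  by rewrite hS exprS mulrA h1// mul1r.
have D0 := disk0.
have gM n : (Bp_seminorm p s (h n \o disk_aut (0%R : C)) <= (M ^+ n)%:E)%E.
  apply: le_trans (Bp_le_seminorm (hX n) D0) _; rewrite lee_fin.
  by apply: le_trans (hN n); rewrite lerDr normc_ge0.
have bound := @power_energy_bound R p s (h 1%N \o disk_aut (0 : C)) (fun n => h n \o disk_aut (0 : C))
  M (M + 1) hp.
have aut0 : disk_aut 0 0 = 0 :> C by rewrite /disk_aut subrr mul0r.
have autK z : disk_aut 0 (- z) = z :> C.
  by rewrite /disk_aut sub0r opprK rmorph0 mul0r subr0 divr1.
exists (M + 1)^-1; first by rewrite invr_gt0 addr_gt0.
move=> z Dz.
have Dz' : disk (- z : C).
  by move: Dz; rewrite /disk/= normc_opp.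
have hz : normc (h 1%N z) <= M + 1.
  rewrite -[z in h 1%N z]autK; apply: (bound _ _ M0 gM _ _ (- z) Dz').
  - exact: (comp_disk_aut_derivable (hX 1%N).1.2 D0).
  - by move=> n w Dw; exact: (hpow n _ (disk_aut_disk D0 Dw)).
  - by rewrite ltrDl.
  - rewrite /= aut0; apply: le_trans (_ : N (h 1%N) <= _).
      by rewrite lerDl fine_seminorm_ge0.
    by rewrite -[M in _ <= M]expr1; exact: hN.
have := congr1 (@Normc.normc R) (h1 z Dz); rewrite Normc.normcM Normc.normc1 => nh.
rewrite -[leLHS]mul1r ler_pdivrMr ?(addr_gt0 M0)//.
apply: le_trans (ler_wpM2l (normc_ge0 (f z - l)) hz).
by rewrite le_eqVlt; apply/orP; left; apply/eqP; symmetry; exact: nh.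
Qed.

End QspSpace.

Unset Implicit Arguments.

Theorem theorem5p2 (R : realType) (p s : R) (f : R[i]^o -> R[i]^o)
    (hp : 1 < p) (hs0 : 0 < s) (hs1 : s < 1)
    (hf : bounded_operator (Qsp p s) (Qsp_norm p s) (mul_operator f)) :
  spectrum (Qsp p s) (Qsp_norm p s) (mul_operator f) = closure (f @` @disk R).
Proof.
apply/seteqP; split => l.
  move=> nI; apply: contrapT => /= ncl; apply: nI.
  have [B [nB fB]] : exists B, nbhs l B /\ ~ (f @` @disk R `&` B !=set0).
    apply: contrapT => /forallNP H; apply: ncl => B nB.
    by have /not_andP[//|/contrapT] := H B.
  move/nbhs_normcP : nB => [d d0 dB].
  apply: (invertible_of_far hp hf d0) => z Dz; rewrite leNgt; apply/negP => zd.
  by apply: fB; exists (f z); split; [exists z|exact: dB].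
move=> cl /(invertible_far hp)[d d0 far].
have nB : nbhs l [set w | Normc.normc (w - l) < d] by apply/nbhs_normcP; exists d.
have [_ [[z Dz <-] /= zd]] := cl _ nB.
by move: zd; rewrite ltNge far.
Qed.
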